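(* Let $P$ be a convex lattice $n$-gon with $B(P)=n$ and $I(P)=k$. Then at most one primitive triangle can be appended to each edge of $P$ without breaking convexity or introducing non-vertex boundary lattice points. Precisely: let $P=P_0,P_1,\ldots,P_m$ be any finite sequence of polygons in which, for each $j=1,\ldots,m$, $P_j$ is obtained from $P_{j-1}$ by appending a primitive triangle $T_j$ to an edge of $P_{j-1}$. Then for every edge $e$ of $P$, at most one of the triangles $T_1,\ldots,T_m$ is appended to $e$ or to an edge descending from $e$.
   Context: A lattice point is an element of $\mathbb{Z}^2$. A lattice polygon is a simple polygon in $\mathbb{R}^2$ whose vertices are lattice points; an $n$-gon has exactly $n$ vertices. A lattice polygon is convex if all its interior angles (at its vertices) are strictly less than $\pi$. $B(P)$ and $I(P)$ denote the numbers of boundary and interior lattice points of $P$. A primitive lattice triangle is a lattice triangle $T$ with $B(T)=3$ and $I(T)=0$ (equivalently, of area $\frac12$). Appending: let $Q$ be a convex lattice $r$-gon with $B(Q)=r$, and let $e=\overline{vw}$ be an edge of $Q$. Appending a primitive triangle to $e$ means choosing a lattice point $z$ lying strictly on the side of the line through $e$ opposite to $Q$, such that $T=\operatorname{conv}\{v,w,z\}$ is a primitive lattice triangle and $Q'=Q\cup T$ is a convex lattice $(r+1)$-gon with $B(Q')=r+1$; the result is $Q'$, in which the edge $e$ is replaced by the two new edges $\overline{vz}$ and $\overline{zw}$. In a sequence of such operations, the edges descending from $e$ are the two new edges created when a triangle is appended to $e$, together with, recursively, the edges descending from those. *)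

(* Defs.v *)
From HB Require Import structures.
From mathcomp Require Import all_boot all_order all_algebra.
From mathcomp Require Import boolp classical_sets functions cardinality reals.

Set Implicit Arguments.
Unset Strict Implicit.
Unset Printing Implicit Defensive.

Import Order.TTheory GRing.Theory Num.Theory.
Local Open Scope classical_set_scope.
Local Open Scope ring_scope.

Definition lattice_point : Type := (int * int)%type.

Definition edge : Type := (lattice_point * lattice_point)%type.

(* Twice the signed area of the triangle abc; it is positive iff the turn
   a -> b -> c is strictly to the left. *)
Definition orient (a b c : lattice_point) : int :=
  (b.1 - a.1) * (c.2 - a.2) - (b.2 - a.2) * (c.1 - a.1).

(* A polygon is encoded by the list of its vertices in counterclockwise cyclic
   order; the starting vertex is irrelevant.  Each edge is the ordered pair of
   its endpoints, so that the polygon lies on its left. *)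
Definition edges (s : seq lattice_point) : seq edge :=
  [seq (v, next s v) | v <- s].

(* Shoelace formula: for a simple polygon, positive iff the vertices are listed
   counterclockwise. *)
Definition signed_double_area (s : seq lattice_point) : int :=
  \sum_(v <- s) (v.1 * (next s v).2 - v.2 * (next s v).1).

Section Plane.
Variable R : realType.

(* R^o, not R, so that the product is an R-module. *)
Definition embed (p : lattice_point) : R^o * R^o := (p.1%:~R, p.2%:~R).

Definition segment (e : edge) : set (R^o * R^o) :=
  [set x | exists t : R,
     0 <= t <= 1 /\ x = (1 - t) *: embed e.1 + t *: embed e.2].

Definition conv_hull (s : seq lattice_point) : set (R^o * R^o) :=
  [set x | exists c : 'I_(size s) -> R,
     [/\ forall i, 0 <= c i, \sum_i c i = 1
       & x = \sum_i c i *: embed s`_i]].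

Definition boundary (s : seq lattice_point) : set (R^o * R^o) :=
  [set x | exists2 e, e \in edges s & segment e x].

Definition simple_chain (s : seq lattice_point) : Prop :=
  forall e f : edge, e \in edges s -> f \in edges s -> e <> f ->
  forall x : R^o * R^o, segment e x -> segment f x ->
  exists v : lattice_point,
    [/\ v \in [:: e.1; e.2], v \in [:: f.1; f.2] & x = embed v].

Definition lattice_polygon (s : seq lattice_point) : Prop :=
  [/\ (3 <= size s)%N, uniq s, simple_chain s & 0 < signed_double_area s].

(* The interior of a simple polygon traversed counterclockwise is on the left,
   so the interior angle at v is less than pi iff the turn at v is strictly to
   the left. *)
Definition convex_lattice_polygon (s : seq lattice_point) : Prop :=
  lattice_polygon s /\
  (forall v, v \in s -> 0 < orient (prev s v) v (next s v)).

Definition boundary_points (s : seq lattice_point) : set lattice_point :=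
  [set p | boundary s (embed p)].

(* Meant for convex polygons only, whose region is the convex hull of the
   vertices. *)
Definition interior_points (s : seq lattice_point) : set lattice_point :=
  [set p | conv_hull s (embed p) /\ ~ boundary s (embed p)].

Definition primitive_triangle (s : seq lattice_point) : Prop :=
  [/\ lattice_polygon s, size s = 3,
      (boundary_points s #= `I_3)%card & (interior_points s #= `I_0)%card].

Definition insert_after (v z : lattice_point) (s : seq lattice_point) :
    seq lattice_point :=
  take (index v s).+1 s ++ z :: drop (index v s).+1 s.

(* Q' is obtained from Q by appending to its edge e the triangle with apex z;
   [:: v; z; w] is the counterclockwise order of the triangle's vertices, as z
   lies to the right of e. *)
Definition appending (Q : seq lattice_point) (e : edge) (z : lattice_point)
    (Q' : seq lattice_point) : Prop :=
  let T := [:: e.1; z; e.2] in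
  [/\ convex_lattice_polygon Q /\ (boundary_points Q #= `I_(size Q))%card,
      e \in edges Q,
      orient e.1 e.2 z < 0 /\ primitive_triangle T,
      Q' = insert_after e.1 z Q /\
      conv_hull Q' = conv_hull Q `|` conv_hull T
    & convex_lattice_polygon Q' /\
      (boundary_points Q' #= `I_(size Q).+1)%card].

End Plane.

(* In a sequence of m steps, step j appends the triangle with apex z j to the
   edge e j.  descends_eq e z a b means that b is a or descends from a.  No
   bookkeeping of time is needed: once a triangle has been appended to an edge,
   the edge is no longer on the boundary of any later polygon. *)
Inductive descends_eq (m : nat) (e : 'I_m -> edge) (z : 'I_m -> lattice_point)
    (a : edge) : edge -> Prop :=
| descends_refl : descends_eq e z a a
| descends_left (j : 'I_m) :
    descends_eq e z a (e j) -> descends_eq e z a ((e j).1, z j)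
| descends_right (j : 'I_m) :
    descends_eq e z a (e j) -> descends_eq e z a (z j, (e j).2).

(* Main.v *)
Require Import Defs.
From mathcomp Require Import all_boot all_order all_algebra.
From mathcomp Require Import boolp classical_sets functions cardinality reals.
From mathcomp Require Import ring lra zify.

(** Suppose a triangle with apex [z] has been appended to the edge [vw], so that
    [v], [z], [w] are consecutive, and let [u] and [x] be the vertices before [v]
    and after [w] in a later polygon.  The triangle is primitive, so in
    suitable lattice coordinates [v = (0, 0)], [w = (1, 0)], [z = (0, -1)].  A
    primitive triangle on [vz] has an apex of the form [(-1, t)], and convexity
    at [z] forces [t >= -1].  If [u = (p, q)], convexity
    at [v] before and after the second step says [p > 0] and [p t + q < 0],
    while [u] lying to the left of the edge [zw] says [q >= p - 1].  The only
    surviving case is [q = p - 1], where [u] lies on the line [zw]; the left turn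
    at [w], with [u] to the left of the edge [wx], then gives [u = w], which is
    impossible in a polygon with more than three vertices.  This is
    [no_second_triangle_left]; the edge [zw] is treated by reflection.  Hence
    neither of the two new edges ever receives a triangle, so both survive in all
    later polygons, no edge that properly descends from [vw] is ever used, and [vw]
    itself, which has left the boundary for good, is not used again.

    Two facts are needed besides.  The first is that a lattice triangle without
    further lattice points has normalized area one
    ([primitive_triangle_area]): otherwise Bezout's identity yields an extra point.

    The second is that every vertex of the polygon lies weakly to the left of
    every edge ([vertex_left_of_edge]), although convexity is only given
    locally, by left turns, together with simplicity.  Here is the argument.  If
    a vertex were strictly to the right of the edge [ab], then a linear height
    function close to the outer normal of [ab] would have a local maximum at [b]
    that is not global.  So let [M] be the lowest local maximum of a height
    function that is injective on the vertices, and suppose that it is not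
    global.  From [M] the polygon descends in both directions, reaches a local
    minimum on either side, and then climbs beyond the height of [M], since no
    local maximum lies lower.  Say that the valley after [M] is the shallower of
    the two.  Just below [M] its descending arm is to the left of the arm that
    returns to [M] from the other valley, because the turn at [M] is to the left;
    and its ascending arm passes to the right of [M], because the turn at the
    bottom is to the left.  So the returning arm starts between the two arms of
    the shallower valley; as edges do not cross, it stays between them down to
    the bottom, where they meet: a contradiction. *)

Set Implicit Arguments.
Unset Strict Implicit.
Unset Printing Implicit Defensive.

Import Order.TTheory GRing.Theory Num.Theory.
Local Open Scope classical_set_scope.
Local Open Scope ring_scope.

(** * Monotone chains that do not cross keep their left-right order *)

Section Chains.
Variable F : realFieldType.
Implicit Types g h y : F.

Definition between (h0 h1 y : F) := (h0 <= y <= h1) || (h1 <= y <= h0).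

(** The first coordinate of the point at height [y] on the line through
    [(g0, h0)] and [(g1, h1)]. *)
Definition abscissa (g0 h0 g1 h1 y : F) := g0 + (y - h0) / (h1 - h0) * (g1 - g0).

Lemma abscissa_start g0 h0 g1 h1 : abscissa g0 h0 g1 h1 h0 = g0.
Proof. by rewrite /abscissa subrr !mul0r addr0. Qed.

Lemma abscissa_sym g0 h0 g1 h1 y :
  h0 != h1 -> abscissa g0 h0 g1 h1 y = abscissa g1 h1 g0 h0 y.
Proof.
move=> ne; rewrite /abscissa; field.
by apply/andP; split; rewrite subr_eq0 // eq_sym.
Qed.

Lemma abscissa_end g0 h0 g1 h1 : h0 != h1 -> abscissa g0 h0 g1 h1 h1 = g1.
Proof. by move=> ne; rewrite abscissa_sym // abscissa_start. Qed.

Lemma abscissa_opp g0 h0 g1 h1 y :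
  abscissa g0 (- h0) g1 (- h1) (- y) = abscissa g0 h0 g1 h1 y.
Proof. by rewrite /abscissa -!opprD invrN mulrNN. Qed.

Lemma abscissa_oppg g0 h0 g1 h1 y :
  abscissa (- g0) h0 (- g1) h1 y = - abscissa g0 h0 g1 h1 y.
Proof. rewrite /abscissa; ring. Qed.

(** The affine case of the intermediate value theorem, so that no continuity is
    involved. *)
Lemma affine_no_root (c d y0 y1 y : F) :
  (forall x, between y0 y1 x -> c + x * d != 0) -> between y0 y1 y ->
  c + y0 * d < 0 -> c + y * d < 0.
Proof.
move=> nz by0 neg; rewrite ltNge le_eqVlt eq_sym (negbTE (nz _ by0)) /=.
apply/negP => pos.
have d0 : d != 0 by apply/eqP => d0; move: neg pos; rewrite d0; lra.
have e : (- c / d) * d = - c by rewrite divfK.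
suff bx : between y0 y1 (- c / d) by move: (nz _ bx); rewrite e subrr eqxx.
move: by0; rewrite /between.
set x := - c / d in e *.
case: (ltgtP d 0) d0 => // dlt _ /orP[] /andP[h1 h2]; apply/orP.
- exfalso; nra.
- right; apply/andP; split; nra.
- left; apply/andP; split; nra.
- exfalso; nra.
Qed.

Lemma abscissa_affine g0 h0 g1 h1 y :
  abscissa g0 h0 g1 h1 y =
  (g0 - h0 / (h1 - h0) * (g1 - g0)) + y * ((g1 - g0) / (h1 - h0)).
Proof. rewrite /abscissa; ring. Qed.

Lemma abscissa_lt_propagate ga ha ga' ha' gb hb gb' hb' y0 y :
  (forall x, between y0 y x ->
     abscissa ga ha ga' ha' x != abscissa gb hb gb' hb' x) ->
  abscissa ga ha ga' ha' y0 < abscissa gb hb gb' hb' y0 ->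
  abscissa ga ha ga' ha' y < abscissa gb hb gb' hb' y.
Proof.
rewrite !abscissa_affine.
set c := _ - _ * _; set d := _ / _; set c' := _ - _ * _; set d' := _ / _.
move=> ne lt0.
have e x : (c - c') + x * (d - d') = (c + x * d) - (c' + x * d') by ring.
rewrite -subr_lt0 -e; apply: (@affine_no_root _ _ y0 y).
- by move=> x bx; rewrite e subr_eq0; move: (ne x bx); rewrite !abscissa_affine.
- by rewrite /between !lexx /= andbT; case: (ltgtP y0 y).
- by rewrite e subr_lt0.
Qed.

Section TwoChains.
Variables (I J : nat) (ag ah bg bh : nat -> F).
Hypothesis ahS : forall i, (i < I)%N -> ah i < ah i.+1.
Hypothesis bhS : forall i, (i < J)%N -> bh i < bh i.+1.
Let XA i y := abscissa (ag i) (ah i) (ag i.+1) (ah i.+1) y.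
Let XB j y := abscissa (bg j) (bh j) (bg j.+1) (bh j.+1) y.

(** Two rising chains that overlap in height from their first edges on, and that
    do not meet above the higher of their two starting points, are ordered
    everywhere as they are on their first edges.  The bottom of the overlap of two
    edges is the start of one of them, hence also the end of the preceding edge of
    that chain: this is the induction step, and along one pair of edges the order
    persists by [abscissa_lt_propagate]. *)
Lemma chain_lt :
  ah 0%N < bh 1%N -> bh 0%N < ah 1%N ->
  (forall i j y, (i < I)%N -> (j < J)%N -> ah 0%N < y -> bh 0%N < y ->
     ah i <= y <= ah i.+1 -> bh j <= y <= bh j.+1 -> XA i y != XB j y) ->
  (forall y, ah 0%N < y -> bh 0%N < y -> y <= ah 1%N -> y <= bh 1%N ->
     XA 0 y < XB 0 y) ->
  forall i j y, (i < I)%N -> (j < J)%N -> ah 0%N < y -> bh 0%N < y ->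
     ah i <= y <= ah i.+1 -> bh j <= y <= bh j.+1 -> XA i y < XB j y.
Proof.
move=> ab ba nc base.
have ah0 i : (i < I)%N -> ah 1%N <= ah i.+1.
  elim: i => [|i IH] lt //; apply: le_trans (IH (ltnW lt)) (ltW (ahS lt)).
have bh0 i : (i < J)%N -> bh 1%N <= bh i.+1.
  elim: i => [|i IH] lt //; apply: le_trans (IH (ltnW lt)) (ltW (bhS lt)).
move=> i j; have [k] := ubnP (i + j)%N; elim: k i j => // k IH i j ijk y iI jJ.
move=> ay by_ /andP[ai ai'] /andP[bj bj'].
have prop y0 : ah 0%N < y0 -> bh 0%N < y0 -> ah i <= y0 -> bh j <= y0 -> y0 <= y ->
  XA i y0 < XB j y0 -> XA i y < XB j y.
  move=> a0 b0 a1 b1 y0y; apply: abscissa_lt_propagate => x.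
  rewrite /between => /orP[] /andP[h1 h2]; apply: nc => //; lra.
case: (leP (bh j) (ah i)) => cmp.
- case: i => [|i] in ijk iI ai ai' prop cmp *.
    case: j => [|j] in ijk jJ bj bj' prop cmp *; first exact: base.
    by have := bh0 j (ltnW jJ); lra.
  have h1 := ah0 i (ltnW iI); have h2 := ahS (ltnW iI).
  have h3 := ahS (leq_trans (ltn0Sn i) (ltnW iI)).
  apply: (prop (ah i.+1)); try lra.
  rewrite {1}/XA abscissa_start -[ag i.+1](@abscissa_end (ag i) (ah i) _ (ah i.+1)) ?lt_eqF //.
  by apply: IH => //; try lra; first exact: ltnW.
- case: j => [|j] in ijk jJ bj bj' prop cmp *.
    case: i => [|i] in ijk iI ai ai' prop cmp *; first exact: base.
    by have := ah0 i (ltnW iI); lra.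
  have h1 := bh0 j (ltnW jJ); have h2 := bhS (ltnW jJ).
  have h3 := bhS (leq_trans (ltn0Sn j) (ltnW jJ)).
  apply: (prop (bh j.+1)); try lra.
  rewrite {1}/XB abscissa_start -[bg j.+1](@abscissa_end (bg j) (bh j) _ (bh j.+1)) ?lt_eqF //.
  by apply: IH => //; try lra; [rewrite addnS in ijk | exact: ltnW].
Qed.
End TwoChains.
End Chains.

(** * A left-turning loop that does not cross itself has a single peak *)

(* [lia] after discarding the facts about heights, which only make its search
   longer. *)
Ltac nat_lia :=
  lazymatch goal with
  | |- is_true (leq _ _) => idtac
  | |- is_true (leq _ _ && _) => idtac
  | |- @eq nat _ _ => idtac
  end;
  repeat match goal with
  | h : context [@Order.le _ _ _ _] |- _ => clear h
  | h : context [@Order.lt _ _ _ _] |- _ => clear h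
  | h : context [@eq (_ -> _) _ _] |- _ => clear h
  | h : context [between] |- _ => clear h
  end; lia.

Section Spiral.
Variable F : realFieldType.

Definition turn (G H : nat -> F) (i j l : nat) : F :=
  (G j - G i) * (H l - H j) - (H j - H i) * (G l - G j).

Definition edge_abscissa (G H : nat -> F) (i : nat) (y : F) : F :=
  abscissa (G i) (H i) (G i.+1) (H i.+1) y.

(** A simple closed polygon with vertices [(G i, H i)], [i < n], all of whose
    turns are to the left; the heights are distinct, so no edge is horizontal and
    crossings can be tested height by height.  Index [n] repeats index [0]. *)
Record left_turning_loop (n : nat) (G H : nat -> F) : Prop := LeftTurningLoop {
  loop_gt1 : (1 < n)%N;
  loop_G : G n = G 0;
  loop_H : H n = H 0;
  loop_inj : forall i j, (i < j < n)%N -> H i != H j;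
  loop_turn : forall i, (i.+1 < n)%N -> 0 < turn G H i i.+1 i.+2;
  loop_turn0 : 0 < turn G H n.-1 0 1;
  loop_simple : forall i j y, (i < j < n)%N ->
    between (H i) (H i.+1) y -> between (H j) (H j.+1) y ->
    edge_abscissa G H i y = edge_abscissa G H j y ->
    (j = i.+1 /\ y = H j) \/ [/\ i = 0, j.+1 = n & y = H 0]%N }.

(** At a local extremum [m] of the height, a left turn from [a] through [m] to [b]
    places the edge [mb] to the right of [ma] above [m] if [m] is a minimum, and
    to the left below [m] if [m] is a maximum. *)
Lemma turn_abscissa (ga ha gm hm gb hb y : F) :
  0 < (ha - hm) * (hb - hm) ->
  0 < (gm - ga) * (hb - hm) - (hm - ha) * (gb - gm) -> y != hm ->
  0 < (y - hm) * (abscissa gm hm gb hb y - abscissa gm hm ga ha y).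
Proof.
move=> same lt ne.
have [a0 b0] : ha - hm != 0 /\ hb - hm != 0.
  by split; apply/eqP => e; move: same; rewrite e ?mul0r ?mulr0 ltxx.
set t := (X in 0 < X) in lt.
suff -> : (y - hm) * (abscissa gm hm gb hb y - abscissa gm hm ga ha y) =
    (y - hm) ^+ 2 * t / ((ha - hm) * (hb - hm)).
  by rewrite divr_gt0 // mulr_gt0 // exprn_even_gt0 //= subr_eq0.
rewrite /abscissa /t; field.
by rewrite a0 b0.
Qed.

Lemma edge_at_height (h : nat -> F) I y : (0 < I)%N -> h 0%N <= y <= h I ->
  exists2 i, (i < I)%N & h i <= y <= h i.+1.
Proof.
case: I => // I _; elim: I => [|I IH] /andP[h1 h2]; first by exists 0%N; rewrite ?h1.
case: (leP y (h I.+1)) => c; last by exists I.+1; rewrite // ltW.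
by have [|i iI hi] := IH; [rewrite h1 | exists i; first exact: ltnW].
Qed.

Lemma betweenC (h0 h1 y : F) : between h0 h1 y = between h1 h0 y.
Proof. by rewrite /between orbC. Qed.

Lemma between_opp (h0 h1 y : F) : - h0 <= y <= - h1 -> between h0 h1 (- y).
Proof. by move=> /andP[a b]; apply/orP; right; apply/andP; split; lra. Qed.

Section TwoValleys.
Variables (n : nat) (G H : nat -> F) (k l k' : nat).
Hypothesis loop : left_turning_loop n G H.
Hypotheses (k0 : (0 < k)%N) (kl : (k < l)%N) (lk : (l < k')%N) (lk' : (k' < n)%N).
Hypothesis dn : forall i, (i < k)%N -> H i.+1 < H i.
Hypothesis up : forall i, (k <= i < l)%N -> H i < H i.+1.
Hypothesis up' : forall i, (k' <= i < n)%N -> H i < H i.+1.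
Hypothesis low : forall i, (k <= i < l)%N -> H i < H 0%N.
Hypothesis hl : H 0%N < H l.
Hypothesis hk : H k' < H k.

Let n1 : (1 < n)%N := loop_gt1 loop.
Let Gn : G n = G 0%N := loop_G loop.
Let Hn : H n = H 0%N := loop_H loop.
Let trn := loop_turn loop.
Let trn0 := loop_turn0 loop.
Let simple := loop_simple loop.

Let kn : (k < n)%N. Proof. by nat_lia. Qed.
Let ek1 : k.-1.+1 = k. Proof. by rewrite prednK. Qed.
Let el1 : l.-1.+1 = l. Proof. by nat_lia. Qed.
Let en1 : n.-1.+1 = n. Proof. by nat_lia. Qed.
Let lowl : H l.-1 < H 0%N. Proof. by apply: low; nat_lia. Qed.
Let lown : H n.-1 < H 0%N.
Proof. by have := @up' n.-1; rewrite en1 Hn; apply; nat_lia. Qed.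
Let lowk : H k < H 0%N. Proof. by apply: low; nat_lia. Qed.

Let eA i : edge_abscissa G H i =1
  fun y => abscissa (G i) (H i) (G i.+1) (H i.+1) y.
Proof. by []. Qed.

(** The two arms of the first valley fan out from its bottom [k], so at the height
    of the peak [0] the rising arm is to the right of the peak. *)
Lemma rising_arm_passes_peak : G 0%N < edge_abscissa G H l.-1 (H 0%N).
Proof.
have := @chain_lt _ k (l - k) (fun i => G (k - i)%N) (fun i => H (k - i)%N)
   (fun j => G (k + j)%N) (fun j => H (k + j)%N).
have upA i : (i < k)%N -> H (k - i)%N < H (k - i.+1)%N.
  by move=> ik; rewrite -(subnSK ik); apply: dn; nat_lia.
have upB j : (j < l - k)%N -> H (k + j)%N < H (k + j.+1)%N.
  by move=> jl; rewrite addnS; apply: up; nat_lia.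
have EA i y : (i < k)%N ->
    abscissa (G (k - i)%N) (H (k - i)%N) (G (k - i.+1)%N) (H (k - i.+1)%N) y =
    edge_abscissa G H (k - i.+1) y.
  by move=> ik; rewrite eA abscissa_sym ?lt_eqF ?upA // subnSK.
move=> /(_ upA upB)/= C; have {}C := C _ _ _ _ k.-1 (l - k).-1 (H 0%N).
move: C; rewrite !subn0 !addn0 !addnS !ek1 !subnn (_ : (k + (l - k).-1)%N = l.-1); last nat_lia.
rewrite (_ : (k - k.-1)%N = 1%N); last nat_lia.
rewrite el1 abscissa_end ?lt_eqF ?dn // => C.
rewrite /edge_abscissa el1; apply: C.
all: try nat_lia.
- by rewrite -[X in H X < _]addn0 -addnS; apply: upB; nat_lia.
- by rewrite -[X in H X < _]subn0; apply: upA.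
- move=> i j y ik jl y0 _ yA yB; apply/eqP.
  rewrite EA // addnS => /(@simple (k - i.+1)%N (k + j)%N y).
  rewrite subnSK // betweenC -addnS /between yA yB => C.
  have [|//|//|[e ye]|[e e' _]] := C; first nat_lia.
    by move: y0; rewrite ye (_ : (k + j)%N = k) ?ltxx //; nat_lia.
  by exfalso; clear -e e' ik jl k0 kl kn lk lk'; lia.
- move=> y y0 _ y1 y2; rewrite addn0.
  have h1 := upA 0%N k0; rewrite subn0 in h1.
  have h2 : H k < H k.+1 by apply: up; nat_lia.
  have tk := @trn k.-1; rewrite ek1 /turn in tk; rewrite subn1 in h1 *.
  rewrite -subr_gt0 -(pmulr_rgt0 _ (_ : 0 < y - H k)) ?subr_gt0 //.
  apply: turn_abscissa.
  + by rewrite mulr_gt0 // subr_gt0.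
  + by apply: tk; nat_lia.
  + by rewrite gt_eqF.
- by [].
- by [].
- by rewrite lexx ltW // dn.
- by rewrite !ltW.
Qed.

(* From here on the chains are read downwards, that is with opposite heights. *)
Let downA i : (i < n - k')%N -> - H (n - i)%N < - H (n - i.+1)%N.
Proof. by move=> ik; rewrite ltrN2 -(@subnSK i n); [apply: up' | ]; nat_lia. Qed.

Let EA i y : (i < n - k')%N ->
  abscissa (G (n - i)%N) (- H (n - i)%N) (G (n - i.+1)%N) (- H (n - i.+1)%N) y =
  edge_abscissa G H (n - i.+1) (- y).
Proof.
move=> ik; have h := downA ik; rewrite ltrN2 in h.
by rewrite -[y in LHS]opprK abscissa_opp eA abscissa_sym ?gt_eqF // subnSK //; nat_lia.
Qed.

Let n0 : (n - k' > 0)%N. Proof. by nat_lia. Qed.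

(** The rising arm is to the right of the peak, where the returning arm ends. *)
Lemma returning_arm_left_of_rising j :
  (j < n - k')%N -> - H (n - j)%N <= - H k -> - H k <= - H (n - j.+1)%N ->
  edge_abscissa G H (n - j.+1) (H k) < G k.
Proof.
move=> jn j1 j2.
have := @chain_lt _ (n - k') (l - k) (fun i => G (n - i)%N) (fun i => - H (n - i)%N)
   (fun j => G (l - j)%N) (fun j => - H (l - j)%N) downA.
have downB i : (i < l - k)%N -> - H (l - i)%N < - H (l - i.+1)%N.
  by move=> ik; rewrite ltrN2 -(@subnSK i l); [apply: up | ]; nat_lia.
have EB i y : (i < l - k)%N ->
    abscissa (G (l - i)%N) (- H (l - i)%N) (G (l - i.+1)%N) (- H (l - i.+1)%N) y =
    edge_abscissa G H (l - i.+1) (- y).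
  move=> ik; have h := downB i ik; rewrite ltrN2 in h.
  by rewrite -[y in LHS]opprK abscissa_opp eA abscissa_sym ?gt_eqF // subnSK //; nat_lia.
have nc i i' y : (i < n - k')%N -> (i' < l - k)%N ->
    - H (n - i)%N <= y <= - H (n - i.+1)%N -> - H (l - i')%N <= y <= - H (l - i'.+1)%N ->
    edge_abscissa G H (n - i.+1) (- y) != edge_abscissa G H (l - i'.+1) (- y).
  move=> ik il /between_opp yA /between_opp yB; apply/eqP => /esym E.
  rewrite betweenC -(@subnSK i n) in yA; last nat_lia.
  rewrite betweenC -(@subnSK i' l) in yB; last nat_lia.
  have C := @simple _ _ _ _ yB yA E; clear E yA yB.
  by have [|[e _]|[e _ _]] := C; try nat_lia; exfalso; clear -e ik il k0 kl kn lk lk'; lia.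
move=> /(_ downB)/= C; have {}C := C _ _ _ _ j (l - k).-1 (- H k).
move: C; rewrite !subn0 Hn EA // !opprK.
have e1 : (l - (l - k).-1)%N = k.+1 by nat_lia.
have e2 : (l - (l - k).-1.+1)%N = k by nat_lia.
rewrite e1 e2.
rewrite abscissa_end; last by rewrite eqr_opp gt_eqF // up //; nat_lia.
apply; try nat_lia.
- by rewrite ltrN2 subn1.
- by rewrite ltrN2 subn1 (lt_trans lown).
- by move=> i i' y ik il _ _ yA yB; rewrite EA // EB //; apply: nc.
- move=> y y0 _ y1 y2; have l0 : (0 < l - k)%N by nat_lia.
  have := EA y n0; have := EB 0%N y l0; rewrite !subn0 Hn => -> ->.
  apply: (@abscissa_lt_propagate _ _ _ _ _ _ _ _ _ (H 0%N)).
  + move=> x bx; rewrite -[x]opprK; apply: nc => //.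
    * by rewrite subn0 Hn subn1; move: bx; rewrite /between; move: y1; rewrite subn1; lra.
    * by rewrite subn0 subn1; move: bx hl y0; rewrite /between; move: y2; rewrite subn1; lra.
  + have first_up := rising_arm_passes_peak.
    by rewrite !subn1 en1 -Hn abscissa_end ?lt_eqF ?Hn // Gn.
- by rewrite ltrN2.
- by rewrite ltrN2 (lt_trans lowk).
- by rewrite j1.
- by rewrite lexx andbT lerN2 ltW // up //; nat_lia.
Qed.

(** The left turn at the peak separates the two arms that meet there. *)
Lemma returning_arm_right_of_falling j :
  (j < n - k')%N -> - H (n - j)%N <= - H k -> - H k <= - H (n - j.+1)%N ->
  G k < edge_abscissa G H (n - j.+1) (H k).
Proof.
move=> jn j1 j2.
have := @chain_lt _ k (n - k') G (fun i => - H i)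
   (fun i => G (n - i)%N) (fun i => - H (n - i)%N).
have downB i : (i < k)%N -> - H i < - H i.+1 by move=> ik; rewrite ltrN2 dn.
have EB i y : abscissa (G i) (- H i) (G i.+1) (- H i.+1) y = edge_abscissa G H i (- y).
  by rewrite -[y in LHS]opprK abscissa_opp.
have nc i i' y : (i < k)%N -> (i' < n - k')%N -> - H 0%N < y ->
    - H i <= y <= - H i.+1 -> - H (n - i')%N <= y <= - H (n - i'.+1)%N ->
    edge_abscissa G H i (- y) != edge_abscissa G H (n - i'.+1) (- y).
  move=> ik il y0 /between_opp yA /between_opp yB; apply/eqP => E.
  rewrite betweenC -(@subnSK i' n) in yB; last nat_lia.
  have C := @simple _ _ _ _ yA yB E; clear E yA yB.
  have [|[e _]|[_ _ e]] := C; [nat_lia | exfalso; clear -e ik il k0 kl kn lk lk'; lia | ].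
  by move: y0; rewrite -e opprK ltxx.
move=> /(_ downB downA)/= C; have {}C := C _ _ _ _ k.-1 j (- H k).
move: C; rewrite !subn0 Hn EA // !opprK ek1.
rewrite abscissa_end; last by rewrite eqr_opp gt_eqF // -{1}ek1 dn //; nat_lia.
apply; try nat_lia.
- by rewrite ltrN2 subn1.
- by rewrite ltrN2 dn.
- by move=> i i' y ik il y0 _ yA yB; rewrite EA // EB //; apply: nc.
- move=> y y0 _ y1 y2.
  have := EA y n0; rewrite EB !subn0 Hn Gn => ->.
  rewrite subn1 /edge_abscissa en1 Hn Gn [X in _ < X]abscissa_sym ?lt_eqF //.
  have h1 : H 1%N < H 0%N by apply: dn.
  rewrite -subr_lt0 -(nmulr_rgt0 _ (_ : - y - H 0%N < 0)); last by rewrite subr_lt0 ltrNl.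
  apply: turn_abscissa.
  + by rewrite nmulr_rgt0 subr_lt0.
  + by move: trn0; rewrite /turn.
  + by rewrite lt_eqF // ltrNl.
- by rewrite ltrN2.
- by rewrite ltrN2.
- by rewrite lexx andbT lerN2 ltW // -{1}ek1 dn //; nat_lia.
- by rewrite j1.
Qed.

(** Starting from the peak [0], vertices [0] to [k] fall into the first valley,
    [k] to [l] rise above the peak, and [k'] to [n] return to the peak from a
    deeper valley.  The returning arm cannot leave the first valley, where it
    is squeezed at the bottom. *)
Lemma no_deeper_valley_beside : False.
Proof.
have [j jn /andP[j1 j2]] : exists2 j, (j < n - k')%N &
    - H (n - j)%N <= - H k <= - H (n - j.+1)%N.
  apply: (edge_at_height (h := fun j => - H (n - j)%N)); first nat_lia.
  by rewrite subn0 Hn subKn ?(ltnW lk') // !lerN2 !ltW.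
have left_of_up := returning_arm_left_of_rising jn j1 j2.
by have := lt_trans left_of_up (returning_arm_right_of_falling jn j1 j2); rewrite ltxx.
Qed.
End TwoValleys.

(** Reflecting the plane and reversing the order of the vertices preserves left
    turns; this exchanges the two valleys next to the peak. *)
Lemma mirror_loop n G H : left_turning_loop n G H ->
  left_turning_loop n (fun i => - G (n - i)%N) (fun i => H (n - i)%N).
Proof.
move=> [n1 Gn Hn inj trn trn0 simple]; split=> //.
- by rewrite subnn subn0 Gn.
- by rewrite subnn subn0 Hn.
- move=> i j /andP[ij jn]; rewrite eq_sym.
  case: i => [|i] in ij *; last by apply: inj; nat_lia.
  by rewrite subn0 Hn eq_sym; apply: inj; nat_lia.
- move=> i i1; have := trn (n - i.+2)%N; rewrite !subnSK; try nat_lia.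
  set a := (n - i.+2)%N; set b := (n - i.+1)%N; set c := (n - i)%N => C.
  have -> : turn (fun i => - G (n - i)%N) (fun i => H (n - i)%N) i i.+1 i.+2 = turn G H a b c.
    by rewrite /turn -/a -/b -/c; ring.
  by apply: C; rewrite /b; nat_lia.
- have e1 : (n - n.-1)%N = 1%N by nat_lia.
  rewrite /turn e1 subn0 subn1 Gn Hn.
  by move: trn0; rewrite /turn; congr (_ < _); ring.
- move=> i j y /andP[ij jn].
  have E i0 : (i0 < n)%N -> between (H (n - i0)%N) (H (n - i0.+1)%N) y ->
      between (H (n - i0.+1)%N) (H (n - i0.+1).+1) y /\
      edge_abscissa (fun i => - G (n - i)%N) (fun i => H (n - i)%N) i0 y =
        - edge_abscissa G H (n - i0.+1) y.
    move=> i0n b0; rewrite betweenC subnSK //; split=> //.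
    rewrite /edge_abscissa abscissa_oppg abscissa_sym ?subnSK //.
    rewrite -(subnSK i0n) eq_sym.
    case: i0 => [|i0] in i0n b0 *; last by apply: inj; nat_lia.
    rewrite subnSK // subn0 Hn eq_sym; apply: inj; nat_lia.
  move=> /E[]; first exact: ltn_trans jn.
  move=> bi -> /E[] // bj -> /oppr_inj/esym C.
  have [|[e ->]|[e1 e2 ->]] := simple _ _ _ _ bj bi C; first nat_lia.
  + by left; split; [nat_lia | congr H; nat_lia].
  + by right; rewrite subn0 Hn; split=> //; nat_lia.
Qed.

(** Beyond a peak that no later peak undercuts, the heights first fall to some [k]
    and then rise until they exceed the peak, at some [l]. *)
Lemma valley n (H : nat -> F) :
  H 1%N < H 0%N ->
  (forall i, (i < n)%N -> H i != H i.+1) -> (forall i, (0 < i < n)%N -> H i != H 0%N) ->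
  (forall c, (c.+1 < n)%N -> H c.+1 < H 0%N -> H c < H c.+1 -> H c.+1 < H c.+2) ->
  (exists2 c, (0 < c < n)%N & H 0%N < H c) ->
  exists k l, [/\ (0 < k < l)%N /\ (l < n)%N,
    forall i, (i < k)%N -> H i.+1 < H i,
    forall i, (k <= i < l)%N -> H i < H i.+1,
    forall i, (0 < i < l)%N -> H i < H 0%N & H 0%N < H l].
Proof.
move=> h1 ne ne0 nomax [c cn hc].
have exl : exists l, (0 < l < n)%N && (H 0%N < H l) by exists c; rewrite cn.
case: (ex_minnP exl) => l /andP[/andP[l0 ln] hl] minl {c cn hc exl}.
have low i : (0 < i < l)%N -> H i < H 0%N.
  move=> /andP[i0 il]; have inn := ltn_trans il ln.
  rewrite lt_neqAle ne0 ?i0 //= leNgt; apply/negP => hi.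
  by have := minl i; rewrite i0 inn hi leqNgt il => /(_ isT).
have exk : exists k, (k < l)%N && (H k < H k.+1).
  apply: contrapT => nk.
  have dec i : (i <= l)%N -> H i <= H 0%N.
    elim: i => // i IH il; apply: le_trans (IH (ltnW il)); rewrite leNgt; apply/negP => hi.
    by apply: nk; exists i; rewrite il.
  by have := dec l (leqnn l); rewrite leNgt hl.
case: (ex_minnP exk) => k /andP[kl hk] mink {exk}; exists k, l.
have k0 : (0 < k)%N by rewrite lt0n; apply/eqP => k0; move: hk; rewrite k0 ltNge ltW.
split=> //; rewrite ?k0 //.
- move=> i ik; rewrite lt_neqAle eq_sym ne; last by apply: ltn_trans ln; apply: ltn_trans kl.
  rewrite leNgt; apply/negP => hi; have := mink i.
  by rewrite hi (ltn_trans ik kl) leqNgt ik => /(_ isT).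
- move=> i /andP[ki il]; rewrite -(subnKC ki) in il *; move: (i - k)%N il => d.
  elim: d => [|d IH] dl; first by rewrite addn0.
  rewrite addnS in dl *; apply: nomax; last by apply: IH; exact: ltnW.
  - exact: ltn_trans dl ln.
  - by apply: low; rewrite dl.
Qed.

(** If another vertex were higher, both sides of the peak [0] would be valleys,
    and [no_deeper_valley_beside], applied to the shallower one, is violated. *)
Lemma single_peak n G H : left_turning_loop n G H ->
  H 1%N < H 0%N -> H n.-1 < H 0%N ->
  (forall c, (c.+1 < n)%N -> H c.+1 < H 0%N -> H c < H c.+1 -> H c.+1 < H c.+2) ->
  forall c, (0 < c < n)%N -> H c < H 0%N.
Proof.
move=> L h1 hn nomax c cn; have [n1 Gn Hn inj _ _ _] := L.
have ne0 i : (0 < i < n)%N -> H i != H 0%N by move=> ?; rewrite eq_sym; apply: inj.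
have ne i : (i < n)%N -> H i != H i.+1.
  rewrite leq_eqVlt => /orP[/eqP e|lt]; last by apply: inj; rewrite ltnSn.
  by rewrite e Hn ne0 //; nat_lia.
rewrite lt_neqAle ne0 //= leNgt; apply/negP => hc.
have [|k [l [[/andP[k0 kl] ln] dn up low hl]]] := valley h1 ne ne0 nomax; first by exists c.
pose H' i := H (n - i)%N.
have [|||||k1 [l1 [[/andP[k10 kl1] ln1] dn1 up1 low1 hl1]]] := @valley n H'.
- by rewrite /H' subn0 Hn subn1.
- by move=> i ii; rewrite /H' -(subnSK ii) eq_sym; apply: ne; nat_lia.
- by move=> i ii; rewrite /H' subn0 Hn; apply: ne0; nat_lia.
- move=> i ii; rewrite /H' subn0 Hn => lt0 lt1.
  have e1 : (n - i.+2).+1 = (n - i.+1)%N by nat_lia.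
  have e2 : (n - i.+1).+1 = (n - i)%N by nat_lia.
  rewrite lt_neqAle -e1 eq_sym ne ?leNgt /=; last by nat_lia.
  apply/negP => lt2; rewrite e1 in lt2.
  have := nomax (n - i.+2)%N; rewrite e1 e2 leq_subr => /(_ isT lt0 lt2).
  by rewrite ltNge ltW.
- by exists (n - c)%N; rewrite /H'; [nat_lia | rewrite subn0 Hn subKn //; nat_lia].
rewrite /H' subn0 Hn in dn1 up1 low1 hl1.
have ll : (l <= n - l1)%N.
  rewrite leqNgt; apply/negP => lt.
  have : H l < H 0%N by rewrite -(@subKn l n) ?(ltnW ln) //; apply: low1; nat_lia.
  by rewrite ltNge ltW.
case: (ltgtP (H (n - k1)%N) (H k)) => cmp.
- apply: (@no_deeper_valley_beside n G H k l (n - k1)) => //; try nat_lia.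
  + move=> i ii; have := dn1 (n - i.+1)%N; rewrite subKn ?subnSK ?subKn; try nat_lia.
    by apply; nat_lia.
  + by move=> i ii; apply: low; nat_lia.
- apply: (@no_deeper_valley_beside n (fun i => - G (n - i)%N) H' k1 l1 (n - k)) => //.
  all: rewrite /H' ?subn0 ?Hn //; try nat_lia.
  + exact: mirror_loop.
  + move=> i ii; rewrite -(@subnSK i n); last nat_lia.
    by apply: dn; nat_lia.
  + by move=> i ii; apply: low1; nat_lia.
  + by rewrite subKn //; nat_lia.
- suff : H k != H (n - k1)%N by rewrite cmp eqxx.
  by apply: inj; nat_lia.
Qed.
End Spiral.

(** * Vertices of a convex polygon lie to the left of its edges *)

Lemma cyclic_enum (T : eqType) (s : seq T) (x : T) : uniq s -> x \in s ->
  exists p : nat -> T,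
  [/\ p 0%N = x, p (size s) = x,
      forall i, (i < size s)%N -> next s (p i) = p i.+1 /\ p i \in s,
      forall i j, (i < j < size s)%N -> p i != p j
    & forall y, y \in s -> exists2 i, (i < size s)%N & y = p i].
Proof.
move=> us xs; have [i s' e] := rot_to xs.
have ur : uniq (x :: s') by rewrite -e rot_uniq.
have sz : size s = (size s').+1 by rewrite -(size_rot i s) e.
have mem y : (y \in s) = (y \in x :: s') by rewrite -e mem_rot.
exists (nth x (x :: s')); rewrite sz; split=> //.
- by rewrite nth_default.
- move=> j jn; rewrite mem mem_nth //; split=> //.
  rewrite -(next_rot i us) e next_nth mem_nth // index_uniq //.
- move=> j k /andP[jk kn]; rewrite nth_uniq ?neq_ltn ?jk //.
  exact: ltn_trans jk kn.
- by move=> y; rewrite mem => ys; exists (index y (x :: s')); rewrite ?index_mem ?nth_index.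
Qed.

Lemma mem_edges s e : (e \in edges s) = (e.1 \in s) && (e.2 == next s e.1).
Proof.
apply/mapP/andP => [[v vs ->] //|[es /eqP e2]].
by exists e.1; rewrite // -e2; case: e {es e2}.
Qed.

Definition dot (a b : lattice_point) : int := a.1 * b.1 + a.2 * b.2.

(** Together with [dot d], the functional [dot (perp d)] forms a positively
    oriented coordinate system, in which [dot d] is the height. *)
Definition perp (a : lattice_point) : lattice_point := (a.2, - a.1).

Lemma dot_gt0 (d : lattice_point) : d != (0, 0) -> 0 < dot d d.
Proof.
move=> d0; rewrite lt_neqAle eq_sym /dot addr_ge0 -?expr2 ?sqr_ge0 // andbT.
move: d0; apply: contraNneq => /eqP; rewrite paddr_eq0 ?sqr_ge0 //.
by rewrite !sqrf_eq0; case: (d) => ? ? /= /andP[/eqP-> /eqP->].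
Qed.

Section Support.
Variable R : realType.
Implicit Types s : seq lattice_point.

Lemma edge_point (d : lattice_point) (a b : lattice_point) (y : R) :
  (dot d a)%:~R != (dot d b)%:~R :> R -> between (dot d a)%:~R (dot d b)%:~R y ->
  exists x : R^o * R^o,
  [/\ segment (a, b) x,
      d.1%:~R * x.1 + d.2%:~R * x.2 = y &
      d.2%:~R * x.1 - d.1%:~R * x.2 =
      abscissa (dot (perp d) a)%:~R (dot d a)%:~R (dot (perp d) b)%:~R (dot d b)%:~R y].
Proof.
move=> ne bt; have nz : (dot d b)%:~R - (dot d a)%:~R != 0 :> R by rewrite subr_eq0 eq_sym.
pose t : R := (y - (dot d a)%:~R) / ((dot d b)%:~R - (dot d a)%:~R).
have te : t * ((dot d b)%:~R - (dot d a)%:~R) = y - (dot d a)%:~R by rewrite divfK.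
exists ((1 - t) *: embed R a + t *: embed R b); split.
- exists t; split=> //; move: bt te nz; rewrite /between.
  move: t ((dot d a)%:~R : R) ((dot d b)%:~R : R) => t u v.
  rewrite subr_eq0; case: (ltgtP u v) => uv bt te // _; apply/andP; split; nra.
- have -> : y = (dot d a)%:~R + t * ((dot d b)%:~R - (dot d a)%:~R) by rewrite te subrKC.
  rewrite /dot /= !rmorphD !rmorphM /= /GRing.scale /=; ring.
- rewrite /abscissa -/t /dot /perp /= !rmorphD !rmorphM rmorphN /= /GRing.scale /=; ring.
Qed.

Lemma dot_perp_inj (d : lattice_point) (x y : R^o * R^o) : d != (0, 0) ->
  d.1%:~R * x.1 + d.2%:~R * x.2 = d.1%:~R * y.1 + d.2%:~R * y.2 :> R ->
  d.2%:~R * x.1 - d.1%:~R * x.2 = d.2%:~R * y.1 - d.1%:~R * y.2 :> R -> x = y.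
Proof.
move: x y => [x1 x2] [y1 y2] /= d0 E1 E2.
have D0 : (d.1%:~R : R) ^+ 2 + (d.2%:~R : R) ^+ 2 != 0.
  move: d0; apply: contraNneq => /eqP; rewrite paddr_eq0 ?sqr_ge0 //.
  rewrite !sqrf_eq0 !intr_eq0 => /andP[/eqP e1 /eqP e2].
  by case: (d) e1 e2 => ? ? /= -> ->.
move: E1 E2 D0; move: (d.1%:~R : R) (d.2%:~R : R) => u v E1 E2 D0.
congr (_, _); apply: (mulfI D0).
- have -> : (u ^+ 2 + v ^+ 2) * x1 = u * (u * x1 + v * x2) + v * (v * x1 - u * x2) by ring.
  by rewrite E1 E2; ring.
- have -> : (u ^+ 2 + v ^+ 2) * x2 = v * (u * x1 + v * x2) - u * (v * x1 - u * x2) by ring.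
  by rewrite E1 E2; ring.
Qed.

Lemma polygon_loop s (p : nat -> lattice_point) (d : lattice_point) :
  convex_lattice_polygon R s -> d != (0, 0) ->
  p (size s) = p 0%N ->
  (forall i, (i < size s)%N -> next s (p i) = p i.+1 /\ p i \in s) ->
  (forall i j, (i < j < size s)%N -> p i != p j) ->
  {in s &, injective (dot d)} ->
  left_turning_loop (size s) (fun i => (dot (perp d) (p i))%:~R : R)
    (fun i => (dot d (p i))%:~R : R).
Proof.
move=> [[s3 us simple _] turns] d0 pn pnext pinj hinj.
have n0 : (0 < size s)%N by apply: leq_trans s3.
have D0 := dot_gt0 d0.
have turnE i j l : 0 < orient (p i) (p j) (p l) ->
   0 < turn (fun i => (dot (perp d) (p i))%:~R : R) (fun i => (dot d (p i))%:~R : R) i j l.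
  rewrite /turn -!intrB -!intrM -intrB ltr0z => o.
  have -> : (dot (perp d) (p j) - dot (perp d) (p i)) * (dot d (p l) - dot d (p j)) -
      (dot d (p j) - dot d (p i)) * (dot (perp d) (p l) - dot (perp d) (p j)) =
      dot d d * orient (p i) (p j) (p l).
    by rewrite /dot /perp /orient /=; ring.
  by rewrite mulr_gt0.
have hne i j : (i < j < size s)%N -> dot d (p i) != dot d (p j).
  move=> ij; apply: contra (pinj _ _ ij) => /eqP /hinj ->//.
  - by apply: (pnext i _).2; case/andP: ij => /ltn_trans; apply.
  - by apply: (pnext j _).2; case/andP: ij.
have hneS i : (i < size s)%N -> dot d (p i) != dot d (p i.+1).
  rewrite leq_eqVlt => /orP[/eqP e|lt]; last by apply: hne; rewrite ltnSn.
  by rewrite e pn eq_sym; apply: hne; clear -e s3; lia.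
split=> //.
- exact: leq_trans s3.
- by rewrite pn.
- by rewrite pn.
- by move=> i j ij; rewrite eqr_int hne.
- move=> i i1; apply: turnE.
  have [e1 m1] := pnext i (ltnW i1); have [e2 m2] := pnext i.+1 i1.
  have := turns _ m2; rewrite e2 -e1 prev_next //.
- apply: turnE.
  have [e1 m1] := pnext 0%N n0; have [|e2 m2] := pnext (size s).-1; first by rewrite prednK.
  have := turns _ m1; rewrite e1 -pn -[in prev _ _](prednK n0) -e2 prev_next //.
- move=> i j y /andP[ij jn] bi bj E.
  have iN := ltn_trans ij jn.
  have [|x [sx x1 x2]] := edge_point _ bi; first by rewrite eqr_int hneS.
  have [|x' [sx' x1' x2']] := edge_point _ bj; first by rewrite eqr_int hneS.
  have xx : x = x' by apply: (dot_perp_inj d0); [rewrite x1 x1' | rewrite x2 x2'].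
  subst x'.
  have ee k : (k < size s)%N -> (p k, p k.+1) \in edges s.
    by move=> kn; have [e m] := pnext k kn; rewrite mem_edges /= e m eqxx.
  have [|v [vi vj xv]] := simple (p i, p i.+1) (p j, p j.+1) (ee i iN) (ee j jn) _ x sx sx'.
    by case=> e _; have := pinj i j; rewrite ij jn e eqxx => /(_ isT).
  have yv : y = (dot d v)%:~R by rewrite -x1 xv /dot /= rmorphD !rmorphM.
  move: vi vj yv; rewrite /= !inE => /orP[]/eqP-> /orP[]/eqP e yv.
  + by have := pinj i j; rewrite ij jn e eqxx => /(_ isT).
  + have [jS|jS|jS] := ltngtP j.+1 (size s).
    * by have := pinj i j.+1; rewrite jS (ltn_trans ij) // e eqxx => /(_ isT).
    * by rewrite ltnNge jn in jS.
    case: i ij e iN {bi E sx ee x1 x2} yv => [|i] ij e iN yv; first by right; rewrite yv.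
    by have := pinj 0%N i.+1; rewrite iN /= e jS pn eqxx => /(_ isT).
  + have [iS|iS|iS] := ltngtP i.+1 j.
    * by have := pinj i.+1 j; rewrite jn iS e eqxx => /(_ isT).
    * by rewrite ltnNge ij in iS.
    * by left; rewrite -iS yv.
  + have iS : (i.+1 < size s)%N by apply: leq_ltn_trans jn.
    have [jS|jS|jS] := ltngtP j.+1 (size s).
    * by have := pinj i.+1 j.+1; rewrite jS ltnS ij e eqxx => /(_ isT).
    * by rewrite ltnNge jn in jS.
    * by have := pinj 0%N i.+1; rewrite iS e jS pn eqxx => /(_ isT).
Qed.

Definition peak s (d v : lattice_point) :=
  [&& v \in s, dot d (next s v) < dot d v & dot d (prev s v) < dot d v].

(** No peak is lower than [M], so [single_peak] applies to the list of vertices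
    that starts at [M]. *)
Lemma lowest_peak_max s d M :
  convex_lattice_polygon R s -> d != (0, 0) -> {in s &, injective (dot d)} ->
  peak s d M -> (forall v, peak s d v -> dot d M <= dot d v) ->
  forall q, q \in s -> dot d q <= dot d M.
Proof.
move=> conv d0 hinj /and3P[Ms nM pM] lowest q qs.
have us : uniq s by case: conv => [[]].
have [p [p0 pn pnext pinj pex]] := cyclic_enum us Ms.
have L : left_turning_loop (size s) _ _ :=
  polygon_loop conv d0 (etrans pn (esym p0)) pnext pinj hinj.
have n1 := loop_gt1 L; have n0 := ltnW n1.
have pprev i : (i < size s)%N -> prev s (p i.+1) = p i.
  by move=> /pnext[<- _]; rewrite prev_next.
have [i iN ->] := pex _ qs; case: i iN => [|i] iN; first by rewrite p0.
have := single_peak L _ _ _ (c := i.+1); rewrite /= !ltr_int p0 => C.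
apply/ltW/C => //.
- by have [<- _] := pnext 0%N n0; rewrite p0.
- by have := pprev (size s).-1; rewrite prednK // pn => <-.
- move=> c cN; rewrite !ltr_int => lt1 lt2; rewrite ltNge; apply/negP => le3.
  have [nc mc] := pnext c.+1 cN.
  suff /lowest : peak s d (p c.+1) by rewrite leNgt lt1.
  rewrite /peak mc nc pprev ?lt2 ?(ltnW cN) // andbT lt_neqAle le3 andbT.
  have m2 : p c.+2 \in s by rewrite -nc mem_next.
  apply/eqP => /(hinj _ _ m2 mc) e.
  case: (ltngtP c.+2 (size s)) => cS.
  + by have := pinj c.+1 c.+2; rewrite cS ltnSn e eqxx => /(_ isT).
  + by rewrite ltnNge cN in cS.
  + by have := pinj 0%N c.+1; rewrite cN -e cS pn p0 eqxx => /(_ isT).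
Qed.

Lemma peak_max s d M :
  convex_lattice_polygon R s -> d != (0, 0) -> {in s &, injective (dot d)} ->
  peak s d M -> forall q, q \in s -> dot d q <= dot d M.
Proof.
move=> conv d0 hinj pM.
have idx v : v \in s -> (index v s < size s)%N by rewrite index_mem.
have Ms : M \in s by case/and3P: pM.
pose P (i : 'I_(size s)) := peak s d s`_i.
have P0 : P (Ordinal (idx M Ms)) by rewrite /P /= nth_index.
case: (arg_minP (fun i : 'I_(size s) => dot d s`_i) P0) => i Pi mini.
have low v : peak s d v -> dot d s`_i <= dot d v.
  move=> pv; have vs : v \in s by case/and3P: pv.
  by have := mini (Ordinal (idx v vs)); rewrite /P /= nth_index //; apply.
move=> q qs; apply: le_trans (low _ pM).
exact: (lowest_peak_max conv d0 hinj Pi low).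
Qed.

(** A vertex strictly to the right of [ab] would be higher than [b] in the direction
    of the outer normal.  Tilting that direction slightly towards [b - a] makes the
    height injective on the vertices and turns [b] into a peak, against
    [peak_max]. *)
Lemma vertex_left_of_edge s (a b q : lattice_point) :
  convex_lattice_polygon R s -> (a, b) \in edges s -> q \in s ->
  0 <= orient a b q.
Proof.
move=> conv; rewrite mem_edges /= => /andP[as_ /eqP eb] qs.
have [[_ us _ _] turns] := conv.
rewrite leNgt; apply/negP => neg.
have bs : b \in s by rewrite eb mem_next.
have pb : prev s b = a by rewrite eb prev_next.
have ltb : 0 < orient a b (next s b) by have := turns b bs; rewrite pb.
pose u : lattice_point := (b.1 - a.1, b.2 - a.2).
pose S : int := \sum_(v <- s) `|dot u v|.
have bound v : v \in s -> `|dot u v| <= S.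
  by move=> vs; rewrite /S (big_rem v) //= lerDl sumr_ge0.
(* With this weight a difference in [orient a b] outweighs any in [dot u]. *)
pose N : int := 1 + 2 * S.
pose d : lattice_point := (N * u.2 + u.1, - N * u.1 + u.2).
have dE v w : dot d v - dot d w = - N * (orient a b v - orient a b w) + (dot u v - dot u w).
  by rewrite /d /dot /orient /u /=; ring.
have un0 : 0 < dot u u.
  apply: dot_gt0; apply: contraTneq ltb => -[u1 u2].
  by rewrite /orient u1 u2 !mul0r subrr ltxx.
have S0 : 0 <= S by apply: sumr_ge0.
have dlt v w : v \in s -> w \in s -> orient a b w < orient a b v -> dot d v < dot d w.
  move=> vs ws o; rewrite -subr_lt0 dE.
  have := bound v vs; have := bound w ws; rewrite !ler_norml => /andP[w1 w2] /andP[v1 v2].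
  have : N <= N * (orient a b v - orient a b w).
    have N0 : 0 < N by rewrite /N; lia.
    by rewrite ler_pMr //; clear -o; lia.
  by rewrite /N; lia.
have hinj : {in s &, injective (dot d)}.
  move=> v w vs ws e; have oe : orient a b v = orient a b w.
    case: (ltgtP (orient a b v) (orient a b w)) => // o.
    - by have := dlt w v ws vs o; rewrite e ltxx.
    - by have := dlt v w vs ws o; rewrite e ltxx.
  have := dE v w; rewrite e oe !subrr mulr0 add0r => /esym ue.
  have oe' : orient a b v - orient a b w = 0 by rewrite oe subrr.
  suff [e1 e2] : v.1 - w.1 = 0 /\ v.2 - w.2 = 0.
    by case: (v) (w) e1 e2 => ? ? [? ?] /= /subr0_eq -> /subr0_eq ->.
  split; apply: (mulfI (lt0r_neq0 un0)); rewrite mulr0.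
  - transitivity (u.1 * (dot u v - dot u w) - u.2 * (orient a b v - orient a b w)).
      by rewrite /dot /orient /u /=; ring.
    by rewrite ue oe' !mulr0 subrr.
  - transitivity (u.2 * (dot u v - dot u w) + u.1 * (orient a b v - orient a b w)).
      by rewrite /dot /orient /u /=; ring.
    by rewrite ue oe' !mulr0 addr0.
have d0 : d != (0, 0).
  apply: contraTneq un0 => dz; suff -> : dot u u = dot d u by rewrite dz /dot !mul0r.
  by rewrite /d /dot /=; ring.
have oa : orient a b a = 0 by rewrite /orient; ring.
have ob : orient a b b = 0 by rewrite /orient; ring.
have pk : peak s d b.
  rewrite /peak bs pb dlt ?ob ?mem_next //= -subr_lt0 dE oa ob subrr mulr0 add0r.
  by have -> : dot u a - dot u b = - dot u u by [rewrite /dot /u /=; ring]; rewrite oppr_lt0.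
have := peak_max conv d0 hinj pk qs; rewrite leNgt dlt //.
by rewrite ob.
Qed.

End Support.

(** * Primitive triangles have normalized area one *)

Lemma size_le_card (T : eqType) (A : set T) n (l : seq T) :
  (A #= `I_n)%card -> uniq l -> (forall x, x \in l -> A x) -> (size l <= n)%N.
Proof.
move=> An; case: l => [|x0 l'] //; set l := x0 :: l' => ul lA.
pose f := nth x0 l.
have fi : {in `I_(size l) &, injective f}.
  move=> i j; rewrite !inE /= => iN jN /eqP; rewrite /f nth_uniq // => /eqP //.
rewrite -card_le_II -(card_le_eqr An) -(card_le_eql (inj_card_eq fi)).
by apply: subset_card_le => _ [i iN <-]; apply/lA/mem_nth.
Qed.

Definition cross (a b : lattice_point) : int := a.1 * b.2 - a.2 * b.1.

(** If [a] is not a primitive vector, take the primitive vector along it.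
    Otherwise complete [a] to a lattice basis by some [f]; then [b] lies on the line
    at lattice distance [cross a b] from that of [a], and a suitable [f + c a]
    lies in the triangle, on the parallel at distance one. *)
Lemma extra_lattice_point (a b : lattice_point) : 1 < cross a b ->
  exists (g : lattice_point) (i j : int),
  [/\ 0 <= i, 0 <= j, i + j <= cross a b,
      cross a b * g.1 = i * a.1 + j * b.1 /\ cross a b * g.2 = i * a.2 + j * b.2
    & g \notin [:: (0, 0); a; b]].
Proof.
set D := cross a b => D1.
have [u [v bez]] := Bezoutz a.1 a.2.
set h := gcdz a.1 a.2 in bez.
have [[x e1] [y e2]] : (exists x, a.1 = x * h) /\ (exists y, a.2 = y * h).
  by split; apply/dvdzP; rewrite ?dvdz_gcdl ?dvdz_gcdr.
have hne : h != 0.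
  apply: contraTneq D1 => h0; rewrite /D /cross e1 e2 h0 !mulr0 !mul0r subrr; lia.
have h0 : 0 < h by rewrite lt_neqAle eq_sym hne.
have bez' : u * x + v * y = 1.
  by apply: (mulIf hne); rewrite mul1r -[RHS]bez e1 e2; ring.
have [h1|h1] : h = 1 \/ 1 < h by lia.
- pose al : int := u * b.1 + v * b.2.
  have bez1 : u * a.1 + v * a.2 = 1 by rewrite bez.
  have D0 : D != 0 by lia.
  have := divz_eq (- al) D; have := modz_ge0 (- al) D0.
  have := @ltz_pmod (- al) D ltac:(lia).
  move: (_ %% _)%Z (_ %/ _)%Z => i q iD i0 qe.
  have qe' : q * D = - al - i by rewrite qe; ring.
  exists (- v - q * a.1, u - q * a.2), i, 1; split=> //=.
  + by move: iD; lia.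
  + split.
    * transitivity (- D * v - (q * D) * a.1); first by ring.
      have k : - D * v + al * a.1 = b.1 * (u * a.1 + v * a.2).
        by rewrite /D /cross /al; ring.
      by rewrite bez1 mulr1 in k; rewrite qe' -[in RHS]k; ring.
    * transitivity (D * u - (q * D) * a.2); first by ring.
      have k : D * u + al * a.2 = b.2 * (u * a.1 + v * a.2).
        by rewrite /D /cross /al; ring.
      by rewrite bez1 mulr1 in k; rewrite qe' -[in RHS]k; ring.
  + have cg : cross a (- v - q * a.1, u - q * a.2) = 1 by rewrite -bez1 /cross /=; ring.
    rewrite !inE !negb_or; apply/and3P; split; apply/eqP => e; move: cg; rewrite e.
    * by rewrite /cross /= !mulr0 subrr.
    * by rewrite /cross mulrC subrr.
    * by rewrite -/D; move: D1; case: (D) => // -[|[]].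
- exists (x, y), (x * b.2 - y * b.1), 0.
  have De : D = h * (x * b.2 - y * b.1) by rewrite /D /cross e1 e2; ring.
  split=> //=.
  + nia.
  + nia.
  + by rewrite De e1 e2; split; ring.
  + rewrite !inE !negb_or; apply/and3P; split; apply/eqP.
    * by case=> x0 y0; move: bez'; rewrite x0 y0 !mulr0; lia.
    * case: (a) e1 e2 => a1 a2 /= -> -> [] x0 y0.
      suff : h = 1 by lia.
      transitivity (u * (x * h) + v * (y * h)); last by rewrite -x0 -y0.
      by rewrite -[LHS]mulr1 -bez'; ring.
    * by case: (b) De => b1 b2 /= De [] x0 y0; move: D1; rewrite De x0 y0; lia.
Qed.

Section Primitive.
Variable R : realType.

Lemma vertex_boundary s v : v \in s -> boundary_points R s v.
Proof.
move=> vs; exists (v, next s v); first by rewrite mem_edges vs eqxx.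
by exists 0; rewrite lexx ler01 subr0 scale1r scale0r addr0.
Qed.

Lemma primitive_triangle_area (v z w : lattice_point) :
  0 < orient v z w -> primitive_triangle R [:: v; z; w] -> orient v z w = 1.
Proof.
move=> o0 [[_ us _ _] _ B3 I0].
pose a : lattice_point := (z.1 - v.1, z.2 - v.2).
pose b : lattice_point := (w.1 - v.1, w.2 - v.2).
have oE : orient v z w = cross a b by [].
apply/eqP; rewrite eq_le andbC oE; apply/andP; split; first by rewrite -oE; lia.
rewrite leNgt; apply/negP => /extra_lattice_point[g [i [j [i0 j0 ij [g1 g2] gn]]]].
pose p : lattice_point := (v.1 + g.1, v.2 + g.2).
have pn : p \notin [:: v; z; w].
  apply: contra gn; rewrite !inE /p /a /b.
  case: (v) (z) (w) (g) => [v1 v2] [z1 z2] [w1 w2] [x y] /=.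
  by rewrite !xpair_eqE; lia.
have D0 : (cross a b)%:~R != 0 :> R by rewrite intr_eq0 -oE gt_eqF.
have Dp : 0 < (cross a b)%:~R :> R by rewrite ltr0z -oE.
have hull : conv_hull [:: v; z; w] (embed R p).
  pose t : R := i%:~R / (cross a b)%:~R; pose u : R := j%:~R / (cross a b)%:~R.
  exists (fun k => nth 0 [:: 1 - t - u; t; u] k); split.
  - have tu : t + u <= 1 by rewrite -mulrDl ler_pdivrMr // mul1r -intrD ler_int.
    case=> [[|[|[|k]]] kl] //=; first lra.
    + by rewrite divr_ge0 ?ler0z // ltW.
    + by rewrite divr_ge0 ?ler0z // ltW.
  - by rewrite !big_ord_recl big_ord0 /=; ring.
  - rewrite !big_ord_recl big_ord0 /= addr0.
    have tD : t * (cross a b)%:~R = i%:~R by rewrite divfK.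
    have uD : u * (cross a b)%:~R = j%:~R by rewrite divfK.
    have e1 : (g.1)%:~R = t * a.1%:~R + u * b.1%:~R :> R.
      by apply: (mulfI D0); rewrite -intrM g1 intrD !intrM -tD -uD; ring.
    have e2 : (g.2)%:~R = t * a.2%:~R + u * b.2%:~R :> R.
      by apply: (mulfI D0); rewrite -intrM g2 intrD !intrM -tD -uD; ring.
    by rewrite /embed /p /=; congr (_, _); rewrite /= intrD ?e1 ?e2 /GRing.scale /= !intrB; ring.
have [bp|nb] := pselect (boundary_points R [:: v; z; w] p).
- suff : (4 <= 3)%N by [].
  apply: (@size_le_card _ _ _ [:: p; v; z; w] B3); first by rewrite cons_uniq pn.
  by move=> x; rewrite inE => /orP[/eqP-> //|]; apply: vertex_boundary.
- suff : (1 <= 0)%N by [].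
  apply: (@size_le_card _ _ _ [:: p] I0) => // x; rewrite inE => /eqP->.
  by split.
Qed.

End Primitive.

(** * Appending a vertex to the cyclic list *)

Lemma insert_afterE (p1 p2 : seq lattice_point) v z : v \notin p1 ->
  insert_after v z (p1 ++ v :: p2) = p1 ++ v :: z :: p2.
Proof.
move=> vp; rewrite /insert_after index_cat (negbTE vp) /= eqxx addn0.
by rewrite -!(cat_rcons v p1) -(size_rcons p1 v) take_size_cat ?drop_size_cat.
Qed.

Lemma insert_after_uniq v z (s : seq lattice_point) :
  uniq (insert_after v z s) = (z \notin s) && uniq s.
Proof. by rewrite /insert_after -cat1s uniq_catCA cat1s cons_uniq cat_take_drop. Qed.

Lemma next_cons2 (T : eqType) (v z : T) r : uniq (v :: z :: r) ->
  [/\ next (v :: z :: r) v = z, next (v :: z :: r) z = next (v :: r) v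
    & forall y, y \in r -> next (v :: z :: r) y = next (v :: r) y].
Proof.
rewrite !cons_uniq inE negb_or => /and3P[/andP[vz vr] zr ur].
split.
- by rewrite next_nth inE eqxx /= eqxx.
- by rewrite !next_nth !inE !eqxx orbT /= !eqxx (negbTE vz).
- move=> y yr; rewrite !next_nth !inE yr !orbT /=.
  have yv : v == y = false by apply: contraNF vr => /eqP->.
  have yz : z == y = false by apply: contraNF zr => /eqP->.
  by rewrite yv yz.
Qed.

Lemma next_insert_after (s : seq lattice_point) v z : v \in s ->
  uniq (insert_after v z s) ->
  [/\ size (insert_after v z s) = (size s).+1,
      forall y, (y \in insert_after v z s) = (y == z) || (y \in s),
      next (insert_after v z s) v = z,
      next (insert_after v z s) z = next s v
    & forall y, y \in s -> y != v -> next (insert_after v z s) y = next s y].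
Proof.
move=> vs us; have szE : size (insert_after v z s) = (size s).+1.
  by rewrite size_cat /= addnS -size_cat cat_take_drop.
have memE y : (y \in insert_after v z s) = (y == z) || (y \in s).
  by rewrite mem_cat inE orbCA -mem_cat cat_take_drop.
have us0 : uniq s by move: us; rewrite insert_after_uniq => /andP[].
suff [nv nz ny] : [/\ next (insert_after v z s) v = z,
    next (insert_after v z s) z = next s v
    & forall y, y \in s -> y != v -> next (insert_after v z s) y = next s y] by [].
move: us us0 {szE memE}; case/splitPr: vs => p1 p2 us us0.
have vp : v \notin p1.
  by move: us0; rewrite cat_uniq /= negb_or => /and3P[_ /andP[]].
rewrite insert_afterE // in us *.
have rE t : rot (size p1) (p1 ++ v :: t) = v :: t ++ p1 by rewrite rot_size_cat.
have u1 := us; rewrite -(rot_uniq (size p1)) rE /= in u1.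
have [h1 h2 h3] := next_cons2 u1.
split; first by rewrite -(next_rot (size p1) us) rE.
  by rewrite -(next_rot (size p1) us) -(next_rot (size p1) us0) !rE.
move=> y ys yv; rewrite -(next_rot (size p1) us) -(next_rot (size p1) us0) !rE.
by apply: h3; move: ys; rewrite !mem_cat inE (negbTE yv) orbC.
Qed.

(** * No primitive triangle fits on a new edge *)

Section Arith.
Implicit Types u v w x z : lattice_point.

(** In the basis [B = w - v], [- A = v - z] one has [u - v = p B - q A] and
    [z' - v = - B - t A], and the hypotheses become linear in [p], [q], [t] except
    for [p t + q < 0]. *)
Lemma no_second_triangle_left u v z w x z' :
  orient v z w = 1 -> orient v z z' = - 1 ->
  0 < orient u v z -> 0 < orient z w x ->
  0 <= orient z w u -> 0 <= orient w x u ->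
  0 < orient u v z' -> 0 < orient z' z w -> u = w.
Proof.
pose A := (z.1 - v.1, z.2 - v.2); pose B := (w.1 - v.1, w.2 - v.2).
pose U := (u.1 - v.1, u.2 - v.2); pose Z := (z'.1 - v.1, z'.2 - v.2).
pose p := cross A U; pose q := cross B U; pose t := cross B Z.
move=> o1 o2 h1 h2 h3 h4 h5 h6.
have AB : cross A B = 1 by rewrite -o1 /cross /orient /=; ring.
have AZ : cross A Z = -1 by rewrite -o2 /cross /orient /=; ring.
have p0 : 0 < p.
  by move: h1; congr (is_true (_ < _)); rewrite /p /cross /orient /=; ring.
have qp : 0 <= q - p + cross A B.
  by move: h3; congr (is_true (_ <= _)); rewrite /p /q /cross /orient /=; ring.
have t2 : 0 < cross A B - cross A Z + t.
  by move: h6; congr (is_true (_ < _)); rewrite /t /cross /orient /=; ring.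
have pt : 0 < - (p * t - q * cross A Z).
  have -> : p * t - q * cross A Z = cross A B * cross U Z by rewrite /p /t /q /cross; ring.
  have e : orient u v z' = - cross U Z by rewrite /cross /orient /=; ring.
  by rewrite AB mul1r -e.
rewrite AB AZ in qp t2 pt.
have [qp0|qp1] : p <= q \/ q = p - 1 by lia.
  by exfalso; nia.
pose X := (x.1 - v.1, x.2 - v.2); pose r := cross A X; pose s := cross B X.
have rs : 0 < s - r + cross A B.
  by move: h2; congr (is_true (_ < _)); rewrite /r /s /cross /orient /=; ring.
have ux : 0 <= (r * q - s * p) + (s - q).
  have -> : r * q - s * p = cross A B * cross X U by rewrite /p /q /r /s /cross; ring.
  have e : orient w x u = cross X U + (s - q) by rewrite /s /q /cross /orient /=; ring.
  by rewrite AB mul1r -e.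
rewrite AB in rs.
have p1 : p = 1 by rewrite qp1 in ux; nia.
have q0 : q = 0 by lia.
have u1 : cross A B * U.1 = p * B.1 - q * A.1 by rewrite /p /q /cross; ring.
have u2 : cross A B * U.2 = p * B.2 - q * A.2 by rewrite /p /q /cross; ring.
move: u1 u2; rewrite AB p1 q0 /U /B /=.
by case: (u) (w) => [? ?] [? ?] /= *; congr (_, _); lia.
Qed.

Definition reflect_point (a : lattice_point) : lattice_point := (- a.1, a.2).

Lemma orient_reflect a b c :
  orient (reflect_point a) (reflect_point b) (reflect_point c) = orient c b a.
Proof. by rewrite /orient /reflect_point /=; ring. Qed.

Lemma orient_cycle a b c : orient a b c = orient b c a.
Proof. by rewrite /orient; ring. Qed.

Lemma no_second_triangle_right u v z w x z' :
  orient v z w = 1 -> orient z w z' = - 1 ->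
  0 < orient u v z -> 0 < orient z w x ->
  0 <= orient v z x -> 0 <= orient u v x ->
  0 < orient z' w x -> 0 < orient v z z' -> x = v.
Proof.
move=> o1 o2 h1 h2 h3 h4 h5 h6.
suff : reflect_point x = reflect_point v.
  by case: (x) (v) => [? ?] [? ?] [/oppr_inj -> ->].
apply: (@no_second_triangle_left _ (reflect_point w) (reflect_point z) _
  (reflect_point u) (reflect_point z')); rewrite orient_reflect // orient_cycle //.
Qed.
End Arith.

Section Appending.
Variable R : realType.

Lemma three_cycle (s : seq lattice_point) v :
  uniq s -> v \in s -> (3 < size s)%N -> next s (next s (next s v)) != v.
Proof.
move=> us vs s3; have [p [p0 _ pn pinj _]] := cyclic_enum us vs.
have n k : (k < size s)%N -> next s (p k) = p k.+1 by move=> /pn[].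
have := n 0%N; have := n 1%N; have := n 2%N; rewrite p0 => n2 n1 n0.
rewrite n0 ?n1 ?n2 -?p0 1?eq_sym ?pinj //; lia.
Qed.

Lemma appending_edges Q e z Q' : appending R Q e z Q' ->
  [/\ size Q' = (size Q).+1, z \notin Q, forall y, y \in Q -> y \in Q',
      (e.1, z) \in edges Q' /\ (z, e.2) \in edges Q'
    & forall b, b \in edges Q -> b != e -> b \in edges Q'].
Proof.
move=> [_ eQ _ [-> _] [[[_ us _ _] _] _]].
move: eQ; rewrite mem_edges => /andP[e1 /eqP e2].
have [sz mem nv nz ny] := next_insert_after e1 us.
have [zQ _] : z \notin Q /\ uniq Q by move: us; rewrite insert_after_uniq => /andP[].
split=> //.
- by move=> y yQ; rewrite mem yQ orbT.
- by rewrite !mem_edges /= !mem e1 !eqxx orbT nv nz e2 !eqxx.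
- move=> b; rewrite !mem_edges => /andP[b1 /eqP b2] be; rewrite mem b1 orbT /= ny ?b2 //.
  by apply: contraNneq be => e1b; rewrite [b]surjective_pairing [e]surjective_pairing b2 e2 e1b.
Qed.

Lemma orient_swap a b c : orient a b c = - orient a c b.
Proof. by rewrite /orient; ring. Qed.

Lemma appending_area Q e z Q' : appending R Q e z Q' -> orient e.1 z e.2 = 1.
Proof.
move=> [_ _ [o T] _ _]; apply: primitive_triangle_area T.
by rewrite orient_swap oppr_gt0.
Qed.

(** The two local configurations are excluded by [no_second_triangle_left] and
    [no_second_triangle_right]; their exceptional case would make the polygon a
    triangle. *)
Lemma no_append_beside Q v z w :
  (v, z) \in edges Q -> (z, w) \in edges Q -> orient v z w = 1 ->
  (3 < size Q)%N ->
  forall e y Q', e = (v, z) \/ e = (z, w) -> ~ appending R Q e y Q'.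
Proof.
move=> vz zw o s3 e y Q' ee A.
have oy : orient e.1 e.2 y = - 1 by rewrite orient_swap (appending_area A).
have [[convQ _] _ _ [Q'E _] [convQ' _]] := A.
have [[_ us _ _] turns] := convQ.
have [[_ us' _ _] turns'] := convQ'.
move: (vz) (zw); rewrite !mem_edges /= => /andP[vQ /eqP nv] /andP[zQ /eqP nz].
have wQ : w \in Q by rewrite nz mem_next.
pose u := prev Q v; pose x := next Q w.
have uQ : u \in Q by rewrite /u mem_prev.
have xQ : x \in Q by rewrite /x mem_next.
have nu : next Q u = v by rewrite /u next_prev.
have pz : prev Q z = v by rewrite nv prev_next.
have pw : prev Q w = z by rewrite nz prev_next.
have o1 : 0 < orient u v z by rewrite nv; apply: turns.
have o2 : 0 < orient z w x by rewrite -pw; apply: turns.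
have orient_refl a b : orient a a b = 0 by rewrite /orient; ring.
have orient_refr a b : orient a b b = 0 by rewrite /orient; ring.
have vzN : v != z by apply: contraTneq o1 => ->; rewrite orient_refr.
have uvN : u != v by apply: contraTneq o1 => ->; rewrite orient_refl.
have wzN : w != z by apply: contraTneq o2 => ->; rewrite orient_refl.
have left_of a b q : (a, b) \in edges Q -> q \in Q -> 0 <= orient a b q.
  by move=> ab qQ; apply: (vertex_left_of_edge convQ ab qQ).
have uv : (u, v) \in edges Q by rewrite mem_edges /= uQ nu eqxx.
have wx : (w, x) \in edges Q by rewrite mem_edges /= wQ eqxx.
case: ee => eE; rewrite {e}eE /= in A oy Q'E *.
- rewrite {Q'}Q'E in A convQ' us' turns' *.
  have [_ mem ny ny' nold] := next_insert_after vQ us'.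
  have Q'v : 0 < orient u v y.
    have pv : prev (insert_after v y Q) v = u by rewrite -{2}nu -nold // prev_next.
    by have := turns' v; rewrite pv ny mem vQ orbT; apply.
  have Q'z : 0 < orient y z w.
    have pz' : prev (insert_after v y Q) z = y by rewrite nv -ny' prev_next.
    by have := turns' z; rewrite pz' nold 1?eq_sym // -nz mem zQ orbT; apply.
  have uw := no_second_triangle_left o oy o1 o2 (left_of _ _ _ zw uQ) (left_of _ _ _ wx uQ) Q'v Q'z.
  by have := three_cycle us vQ s3; rewrite -nv -nz -uw nu eqxx.
- rewrite {Q'}Q'E in A convQ' us' turns' *.
  have [_ mem ny ny' nold] := next_insert_after zQ us'.
  have Q'z : 0 < orient v z y.
    have pz' : prev (insert_after z y Q) z = v by rewrite {2}nv -(nold v) // prev_next.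
    by have := turns' z; rewrite pz' ny mem zQ orbT; apply.
  have Q'w : 0 < orient y w x.
    have pw' : prev (insert_after z y Q) w = y by rewrite nz -ny' prev_next.
    by have := turns' w; rewrite pw' nold // mem wQ orbT; apply.
  have xv := no_second_triangle_right o oy o1 o2 (left_of _ _ _ vz xQ) (left_of _ _ _ uv xQ) Q'w Q'z.
  by have := three_cycle us vQ s3; rewrite -nv -nz -/x xv eqxx.
Qed.
End Appending.

(** * Sequences of appended triangles *)

Section Process.
Variables (R : realType) (m : nat) (Ps : nat -> seq lattice_point).
Variables (e : 'I_m -> edge) (z : 'I_m -> lattice_point).
Hypothesis stepP : forall j : 'I_m, appending R (Ps j) (e j) (z j) (Ps j.+1).

Lemma vertices_persist t t' q : (t <= t' <= m)%N -> q \in Ps t -> q \in Ps t'.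
Proof.
move=> /andP[tt t'm] qt; rewrite -(subnKC tt) in t'm *.
move: (t' - t)%N t'm => d {t' tt}; elim: d => [|d IH] dm; first by rewrite addn0.
rewrite addnS in dm *.
by have [_ _ sub _ _] := appending_edges (stepP (Ordinal dm)); apply/sub/IH/ltnW.
Qed.

(** An edge disappears only when a triangle is appended to it, and this never
    happens to the two new edges. *)
Lemma new_edges_persist (i : 'I_m) t : (i < t <= m)%N ->
  [/\ (3 < size (Ps t))%N, ((e i).1, z i) \in edges (Ps t)
     & (z i, (e i).2) \in edges (Ps t)].
Proof.
move=> /andP[it tm]; rewrite -(subnKC it) in tm *.
move: (t - i.+1)%N tm => d {t it}; elim: d => [|d IH] dm.
  have [sz _ _ [e1 e2] _] := appending_edges (stepP i).
  have [[[[s3 _ _ _] _] _] _ _ _ _] := stepP i.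
  by rewrite addn0 sz ltnS.
rewrite addnS in dm *.
have [s3 e1 e2] := IH (ltnW dm).
have A := stepP (Ordinal dm); have [sz _ _ _ keep] := appending_edges A.
have area := appending_area (stepP i).
have no b : b = ((e i).1, z i) \/ b = (z i, (e i).2) -> b != e (Ordinal dm).
  move=> be; apply/eqP => bE.
  by apply: (no_append_beside e1 e2 area s3 be); rewrite bE; exact: A.
split; first by rewrite sz ltnW.
- by apply/keep => //; apply: no; left.
- by apply/keep => //; apply: no; right.
Qed.

(** After the first triangle on [vw] the successor of [v] is the new apex for
    ever. *)
Lemma append_once (i j : 'I_m) : e i = e j -> i = j.
Proof.
wlog lt : i j / (i < j)%N.
  move=> W eij; case: (ltngtP i j) => [|lt|/val_inj//]; first by move/W; apply.
  by apply/esym/W.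
move=> eij; have [_ eQ _ _ _] := stepP j.
have [_ e1 _] := new_edges_persist (introT andP (conj lt (ltnW (ltn_ord j)))).
have [_ zN _ _ _] := appending_edges (stepP i).
move: eQ e1; rewrite eij !mem_edges /= => /andP[_ /eqP e2] /andP[_ /eqP zE].
case/negP: zN; rewrite zE -e2 -eij.
have [_ eQi _ _ _] := stepP i.
by move: eQi; rewrite mem_edges => /andP[e1i /eqP ->]; rewrite mem_next.
Qed.

(** A triangle on a new edge cannot precede that edge, since its apex is a fresh
    vertex, and cannot follow it by [no_append_beside]. *)
Lemma new_edge_untouched (i j : 'I_m) : e j <> ((e i).1, z i) /\ e j <> (z i, (e i).2).
Proof.
suff no : e j = ((e i).1, z i) \/ e j = (z i, (e i).2) -> False.
  by split=> E; [apply: no; left | apply: no; right].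
move=> E; have [_ eQ _ _ _] := stepP j.
have zQ : z i \in Ps j.
  move: eQ; rewrite mem_edges => /andP[q /eqP q2].
  case: E => E; last by have -> : z i = (e j).1 by rewrite E.
  by have -> : z i = (e j).2; [rewrite E | rewrite q2 mem_next].
have [ji|ij] := leqP j i.
  have [_ /negP zN _ _ _] := appending_edges (stepP i); apply: zN.
  by apply: vertices_persist zQ; rewrite ji ltnW.
have [s3 e1 e2] := new_edges_persist (introT andP (conj ij (ltnW (ltn_ord j)))).
exact: (no_append_beside e1 e2 (appending_area (stepP i)) s3 E (stepP j)).
Qed.

Lemma descends_appended (a b : edge) : descends_eq e z a b ->
  b = a \/ exists i, b = ((e i).1, z i) \/ b = (z i, (e i).2).
Proof. by case=> [|j _|j _]; [left | right; exists j; left | right; exists j; right]. Qed.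
End Process.

Theorem theorem5 (R : realType) (n k : nat) (P : seq lattice_point)
  (convP : convex_lattice_polygon R P)
  (sizeP : size P = n)
  (BP : (boundary_points R P #= `I_n)%card)
  (IP : (interior_points R P #= `I_k)%card)
  (m : nat) (Ps : nat -> seq lattice_point)
  (e : 'I_m -> edge) (z : 'I_m -> lattice_point)
  (Ps0 : Ps 0%N = P)
  (stepP : forall j : 'I_m, appending R (Ps j) (e j) (z j) (Ps j.+1))
  (a : edge) (aP : a \in edges P) (i j : 'I_m) :
  descends_eq e z a (e i) -> descends_eq e z a (e j) -> i = j.
Proof.
have eq_a l : descends_eq e z a (e l) -> e l = a.
  case/descends_appended => [//|[l' E]].
  by have [n1 n2] := new_edge_untouched stepP l' l; case: E.
by move=> /eq_a ei /eq_a ej; apply: (append_once stepP); rewrite ei ej.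
Qed.
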